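(* The expected rumor spreading time of the push-pull protocol on the complete graph with $n$ vertices is $\log_3 n+\log_2\ln n\pm O(1)$.
   Context: Push-pull protocol on the complete graph with $n$ nodes: initially exactly one node is informed. In each round, every node (informed or not) calls a node chosen independently and uniformly at random from all $n$ nodes (including itself); if one of caller and called node was informed at the beginning of the round, then both are informed from the end of that round on. The rumor spreading time is the number of rounds until all nodes are informed. $\pm O(1)$ denotes a deviation bounded in absolute value by a constant independent of $n$, for all sufficiently large $n$. *)

(* Defs.v *)
From HB Require Import structures.
From mathcomp Require Import all_boot all_order all_algebra finmap.
From mathcomp Require Import all_classical all_reals all_analysis.

Set Implicit Arguments.
Unset Strict Implicit.
Unset Printing Implicit Defensive.

Import Order.TTheory GRing.Theory Num.Theory.

Local Open Scope classical_set_scope.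
Local Open Scope ring_scope.
Local Open Scope ereal_scope.

(* The target S carries the discrete sigma-algebra: every A j is allowed. *)
Definition mutually_independent d (Omega : measurableType d) (R : realType)
    (P : probability Omega R) (I : choiceType) (S : Type)
    (X : I -> Omega -> S) : Prop :=
  forall (J : {fset I}) (A : I -> set S),
    P (\bigcap_(j in [set` J]) (X j @^-1` A j))
    = \prod_(j <- J) P (X j @^-1` A j).

(* call t v w is the node called by v in round t; it may be v itself. *)
Record random_calls d (Omega : measurableType d) (R : realType)
    (P : probability Omega R) (n : nat)
    (call : nat -> 'I_n -> Omega -> 'I_n) : Prop := RandomCalls {
  calls_measurable : forall t v (A : set 'I_n),
    measurable (call t v @^-1` A) ;
  calls_uniform : forall t v u,
    P (call t v @^-1` [set u]) = (n%:R^-1)%:E ;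
  calls_independent :
    mutually_independent P (fun tv : nat * 'I_n => call tv.1 tv.2) }.

Definition push_pull_round (n : nat) (c : 'I_n -> 'I_n) (S : {set 'I_n}) :
    {set 'I_n} :=
  (S :|: [set v | [exists u, ((u \in S) || (c u \in S))
                             && ((v == u) || (v == c u))]])%SET.

Fixpoint informed (n : nat) (c : nat -> 'I_n -> 'I_n) (v0 : 'I_n) (t : nat) :
    {set 'I_n} :=
  if t is t'.+1 then push_pull_round (c t') (informed c v0 t')
  else [set v0]%SET.

(* The infimum is +oo on outcomes where some node is never informed. *)
Definition spreading_time (R : realType) (n : nat) (c : nat -> 'I_n -> 'I_n)
    (v0 : 'I_n) : \bar R :=
  ereal_inf [set (t%:R)%:E | t in [set t | informed c v0 t = [set: 'I_n]%SET]].

Definition expected_spreading_time d (Omega : measurableType d)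
    (R : realType) (P : probability Omega R) (n : nat)
    (call : nat -> 'I_n -> Omega -> 'I_n) (v0 : 'I_n) : \bar R :=
  \int[P]_w spreading_time R (fun t v => call t v w) v0.

(* Main.v *)
Require Import Defs.
From HB Require Import structures.
From mathcomp Require Import all_boot all_order all_algebra finmap.
From mathcomp Require Import all_classical all_reals all_analysis.
From mathcomp Require Import measurable_realfun zify ring lra.

Import Order.TTheory GRing.Theory Num.Theory.

Local Open Scope ring_scope.

(* A round of the chain of informed sets is controlled by the mean and the variance of the number
   u' of nodes left uninformed: given k informed and u = n - k uninformed nodes, each uninformed
   node stays so with probability q = (u/n) (1 - 1/n)^k, and any two of them with probability at
   most q^2, so the mean is u q and the variance at most u q (1 - q). The expected time is then
   compared with potentials that change by 1 per round in expectation.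
   Upper bound: log_3 (n/k) + O(1/k) + O(u/n) + sum_i min(1, u 2^(2^i) / n). While k <= n/4, the
   logarithm loses 1 - O(1/k) - O(k/n) and the next two terms absorb the errors; later, u' has
   mean at most u^2/n, which shifts the concave summands by one index.
   Lower bound: log_3 (n / min(k, n/10)) + #{i | u >= b_i} with b_(i+1) = b_i^2 / (32 n). Jensen
   and E k' <= 3 k handle the first term, Chebyshev's inequality the second one. *)

(** * Uniform averages over the call functions of one round *)

Section Average.
Context {R : realType} {n : nat}.
Implicit Types f g : {ffun 'I_n -> 'I_n} -> R.

Definition avg f : R := (n%:R ^+ n)^-1 * \sum_c f c.

Lemma avgD f g : avg (fun c => f c + g c) = avg f + avg g.
Proof. by rewrite /avg big_split mulrDr. Qed.

Lemma avgZ a f : avg (fun c => a * f c) = a * avg f.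
Proof. by rewrite /avg -mulr_sumr mulrCA. Qed.

Lemma avg_sum (I : Type) (r : seq I) (A : pred I) (F : I -> _ -> R) :
  avg (fun c => \sum_(i <- r | A i) F i c) = \sum_(i <- r | A i) avg (F i).
Proof. by rewrite /avg exchange_big mulr_sumr. Qed.

Lemma le_avg f g : (forall c, f c <= g c) -> avg f <= avg g.
Proof.
by move=> fg; rewrite ler_wpM2l ?ler_sum// invr_ge0 exprn_ge0// ler0n.
Qed.

Lemma eq_avg f g : (forall c, f c = g c) -> avg f = avg g.
Proof. by move=> fg; rewrite /avg (eq_bigr g). Qed.

(** The values of a uniformly random function are independent; algebraically this is distributivity
    of the product over the sums. *)
Lemma avg_prod (F : 'I_n -> 'I_n -> R) :
  avg (fun c => \prod_u F u (c u)) = \prod_u (n%:R^-1 * \sum_j F u j).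
Proof.
by rewrite /avg big_split/= prodr_const card_ord exprVn -bigA_distr_bigA.
Qed.

Lemma avg_cst a : avg (fun=> a) = a.
Proof.
rewrite /avg sumr_const card_ffun card_ord -[a *+ _]mulr_natl mulrA natrX.
(* For [n = 0] there is exactly one function, and [0 ^+ 0 = 1]. *)
rewrite mulVf ?mul1r//; case: (n) => [|m]; first by rewrite oner_neq0.
by rewrite expf_neq0// pnatr_eq0.
Qed.

Lemma avg_ge0 f : (forall c, 0 <= f c) -> 0 <= avg f.
Proof. by move=> f0; rewrite -[0]avg_cst le_avg. Qed.

Lemma avgN f : avg (fun c => - f c) = - avg f.
Proof. by rewrite -mulN1r -avgZ; apply: eq_avg => c; rewrite mulN1r. Qed.

Lemma avgB f g : avg (fun c => f c - g c) = avg f - avg g.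
Proof. by rewrite avgD avgN. Qed.

End Average.

(** * One round: which sets of nodes stay uninformed *)

Section Round.
Context {R : realType} {n : nat}.
Implicit Types (c : {ffun 'I_n -> 'I_n}) (S D : {set 'I_n}).

Lemma subset_round (c : 'I_n -> 'I_n) S : S \subset push_pull_round c S.
Proof. exact: finset.subsetUl. Qed.

Lemma notin_round (c : 'I_n -> 'I_n) S v : v \notin S ->
  (v \notin push_pull_round c S) =
  (c v \notin S) && [forall u in S, c u != v].
Proof.
move=> vS; rewrite !inE (negbTE vS)/= -negb_exists_in -negb_or; congr negb.
apply/existsP/orP => [[u /andP[uc /orP[]/eqP vE]]|[cvS|]].
- by subst u; move: uc; rewrite (negbTE vS)/=; left.
- case/orP: uc => [uS|]; last by rewrite -vE (negbTE vS).
  by right; apply/existsP; exists u; rewrite uS vE eqxx.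
- by exists v; rewrite cvS orbT eqxx.
- by case/existsP => u /andP[uS /eqP<-]; exists u; rewrite uS eqxx orbT.
Qed.

(** Each factor depends on the call of a single node, the form [avg_prod] requires. Calls from nodes
    outside [D] and [S] cannot inform [D], hence the factor 1. *)
Lemma disjoint_round c S D : [disjoint D & S] ->
  ([disjoint D & push_pull_round c S])%:R =
  \prod_u (if u \in D then (c u \notin S)%:R
           else if u \in S then (c u \notin D)%:R else 1) :> R.
Proof.
move=> DS; have [DS'|DS'] := boolP [disjoint D & push_pull_round c S].
- rewrite big1// => u _; have [uD|uD] := boolP (u \in D).
    have := disjointFr DS' uD; move/negbT; rewrite notin_round ?(disjointFr DS uD)//.
    by case/andP => ->.
  have [uS|//] := boolP (u \in S).
  have [cuD|//] := boolP (c u \in D).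
  have := disjointFr DS' cuD; move/negbT; rewrite notin_round ?(disjointFr DS cuD)//.
  by case/andP => _ /forall_inP /(_ u uS); rewrite eqxx.
- move: DS'; rewrite disjoint_subset => /subsetPn[v vD]; rewrite inE negbK => vr.
  have vS : v \notin S by rewrite (disjointFr DS vD).
  move: vr; apply: contraTeq => /=; rewrite eq_sym => /prodf_neq0 H.
  rewrite notin_round//; apply/andP; split.
    by have := H v isT; rewrite vD; case: (_ \notin _); rewrite ?eqxx.
  apply/forall_inP => u uS; apply: contraTneq (H u isT) => cuv.
  by rewrite (disjointFl DS uS) uS cuv vD eqxx.
Qed.

Lemma avg_disjoint_round S D : [disjoint D & S] ->
  avg (fun c => ([disjoint D & push_pull_round c S])%:R) =
  (#|~: S|%:R / n%:R) ^+ #|D| * (#|~: D|%:R / n%:R) ^+ #|S| :> R.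
Proof.
move=> DS; under eq_avg do rewrite disjoint_round//.
rewrite (avg_prod (fun u j => if u \in D then (j \notin S)%:R
           else if u \in S then (j \notin D)%:R else 1)).
have sumC (B : {set 'I_n}) : \sum_j (j \notin B)%:R = #|~: B|%:R :> R.
  rewrite -sum1_card natr_sum big_mkcond/= [RHS]big_mkcond/=.
  by apply: eq_bigr => j _; rewrite inE; case: ifP.
rewrite (eq_bigr (fun u => (if u \in D then #|~: S|%:R / n%:R else 1) *
    (if u \in S then #|~: D|%:R / n%:R else 1))) => [|u _].
  by rewrite big_split/= -!big_mkcond/= !prodr_const.
have [uD|uD] := boolP (u \in D).
  by rewrite sumC (disjointFr DS uD) mulr1 mulrC.
have [uS|uS] := boolP (u \in S); first by rewrite sumC mul1r mulrC.
rewrite sumr_const card_ord mulr1 mulVf// pnatr_eq0 -lt0n.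
exact: leq_ltn_trans (ltn_ord u).
Qed.

End Round.

(** * Mean and variance of the number of uninformed nodes after a round *)

Section Moments.
Context {R : realType} {n : nat}.
Variable S : {set 'I_n}.

Local Notation N := (n%:R : R).
Local Notation k := (#|S|%:R : R).
Local Notation u := (#|~: S|%:R : R).
Local Notation u' c := (#|~: push_pull_round c S|%:R : R).
Local Notation k' c := (#|push_pull_round c S|%:R : R).

Lemma natr_cardsC (A : {set 'I_n}) : #|A|%:R + #|~: A|%:R = N.
Proof. by rewrite -natrD cardsC card_ord. Qed.

(** The probability q of the overview: the node's own call avoids [S], and every call from [S]
    avoids the node. *)
Definition miss : R := u / N * (1 - N^-1) ^+ #|S|.

Lemma natr_cardC_round (c : {ffun 'I_n -> 'I_n}) :
  u' c = \sum_(v in ~: S) ([disjoint [set v] & push_pull_round c S])%:R.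
Proof.
rewrite -sum1_card natr_sum [RHS]big_mkcond/= [LHS]big_mkcond/=.
apply: eq_bigr => v _; rewrite disjoints1 !finset.in_setC.
have [vS|vS] := boolP (v \in S); last by case: ifP.
by rewrite (fintype.subsetP (subset_round _ _) _ vS).
Qed.

Hypothesis n_gt1 : (1 < n)%N.

Let N_gt0 : 0 < N. Proof. by rewrite ltr0n (ltn_trans _ n_gt1). Qed.

Lemma avg_miss v : v \notin S ->
  avg (fun c : {ffun 'I_n -> 'I_n} => ([disjoint [set v] & push_pull_round c S])%:R) = miss.
Proof.
move=> vS; rewrite avg_disjoint_round ?disjoints1// cards1 expr1; congr (_ * _ ^+ _).
rewrite cardsC1 card_ord -subn1 natrB ?(ltn_trans _ n_gt1)//.
by rewrite mulrBl divff ?mul1r// gt_eqF.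
Qed.

Lemma avg_cardC : avg (fun c : {ffun 'I_n -> 'I_n} => u' c) = u * miss.
Proof.
under eq_avg do rewrite natr_cardC_round.
rewrite avg_sum mulr_natl -sumr_const; apply: eq_bigr => v.
by rewrite finset.in_setC; exact: avg_miss.
Qed.

Lemma avg_card : avg (fun c : {ffun 'I_n -> 'I_n} => k' c) = N - u * miss.
Proof.
rewrite -avg_cardC -{1}[N](avg_cst (n := n)) -avgB; apply: eq_avg => c.
by rewrite -(natr_cardsC (push_pull_round c S)) addrK.
Qed.

(** Negative correlation: an informed node avoids both v and w with probability [1 - 2 / N], which
    is at most [(1 - 1 / N) ^ 2]. *)
Lemma avg_miss2_le v w : v \notin S -> w \notin S -> v != w ->
  avg (fun c : {ffun 'I_n -> 'I_n} => ([disjoint [set v; w] & push_pull_round c S])%:R)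
   <= miss ^+ 2.
Proof.
move=> vS wS vw; have D2 : #|[set v; w]%SET| = 2%N by rewrite cards2 vw.
rewrite avg_disjoint_round; last first.
  by rewrite finset.disjoints_subset; apply/fintype.subsetP => z; rewrite !inE => /orP[]/eqP->.
rewrite /miss D2 [(_ * _ ^+ #|S|) ^+ 2]exprMn ler_wpM2l ?exprn_ge0 ?divr_ge0//.
rewrite exprAC lerXn2r ?nnegrE ?divr_ge0 ?exprn_ge0//.
  by rewrite subr_ge0 invf_le1// ler1n ltnW.
have -> : (#|~: [set v; w]%SET|%:R : R) = N - 2.
  by rewrite -(natr_cardsC [set v; w]%SET) D2; ring.
rewrite -subr_ge0 (_ : _ - _ = N^-1 ^+ 2) ?exprn_ge0 ?invr_ge0//.
by field; rewrite gt_eqF.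
Qed.

(** Write the square as a sum over pairs of nodes: the u diagonal pairs contribute q each, the
    [u * (u - 1)] others at most [q ^ 2] each. *)
Lemma avg_cardC_sqr_le :
  avg (fun c : {ffun 'I_n -> 'I_n} => u' c ^+ 2) <= u * miss + u * (u - 1) * miss ^+ 2.
Proof.
have E (c : {ffun 'I_n -> 'I_n}) : u' c ^+ 2 = \sum_(v in ~: S) \sum_(w in ~: S)
    ([disjoint [set v; w] & push_pull_round c S])%:R :> R.
  rewrite expr2 {1}natr_cardC_round mulr_suml; apply: eq_bigr => v _.
  rewrite natr_cardC_round mulr_sumr; apply: eq_bigr => w _.
  rewrite !disjoints1 -natrM mulnb finset.disjoints_subset; congr ((_)%:R); congr nat_of_bool.
  by rewrite finset.subUset !finset.sub1set !finset.in_setC.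
under eq_avg do rewrite E.
rewrite avg_sum.
have -> : u * miss + u * (u - 1) * miss ^+ 2 = \sum_(v in ~: S) (miss + (u - 1) * miss ^+ 2).
  by rewrite sumr_const -mulr_natl; ring.
apply: ler_sum => v vS; rewrite avg_sum (bigD1 v)//= lerD//.
  under eq_avg do rewrite finset.setUid.
  by rewrite avg_miss// -finset.in_setC.
rewrite (le_trans (ler_sum _ (G := fun=> miss ^+ 2) _))//.
  by move=> w /andP[wS wv]; apply: avg_miss2_le; rewrite -?finset.in_setC// eq_sym.
rewrite (eq_bigl (mem (~: S :\ v)%SET)) => [|w]; last by rewrite !inE andbC.
rewrite sumr_const -[_ *+ _]mulr_natl.
by rewrite [X in (X%:R - 1) * _](cardsD1 v) vS natrD [1%:R + _]addrC addrK.
Qed.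

Lemma var_cardC_round :
  avg (fun c : {ffun 'I_n -> 'I_n} => (u' c - u * miss) ^+ 2) <= u * miss * (1 - miss).
Proof.
have E (c : {ffun 'I_n -> 'I_n}) : (u' c - u * miss) ^+ 2 =
    u' c ^+ 2 + (- (2 * u * miss) * u' c + (u * miss) ^+ 2) by ring.
rewrite (eq_avg _ _ E) avgD avgD avgZ avg_cst avg_cardC.
have := avg_cardC_sqr_le; nra.
Qed.

End Moments.

(** * Bernoulli's inequality and bounds on the survival probability q *)

Lemma bernoulli_ineq {R : realDomainType} (a : R) (j : nat) : -1 <= a ->
  1 + j%:R * a <= (1 + a) ^+ j.
Proof.
move=> a1; elim: j => [|j IH]; first by rewrite mul0r addr0 expr0.
rewrite exprS -natr1.
apply: (@le_trans _ _ ((1 + a) * (1 + j%:R * a))); last by rewrite ler_wpM2l//; lra.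
have := sqr_ge0 a; have := ler0n R j; nra.
Qed.

Section MissBounds.
Context {R : realType} {n : nat}.
Variable S : {set 'I_n}.
Hypothesis n_gt1 : (1 < n)%N.

Local Notation N := (n%:R : R).
Local Notation k := (#|S|%:R : R).
Local Notation u := (#|~: S|%:R : R).
Local Notation q := (@miss R n S).
Local Notation u' c := (#|~: push_pull_round c S|%:R : R).

Let N_ge2 : 2 <= N. Proof. by rewrite ler_nat. Qed.
Let Ninv : 0 <= 1 - N^-1 <= 1.
Proof.
have N0 : 0 < N by have := N_ge2; lra.
by rewrite subr_ge0 invf_le1// lerBlDr lerDl invr_ge0 (ltW N0) andbT; have := N_ge2; lra.
Qed.

Lemma miss_ge0 : 0 <= q.
Proof. by case/andP: Ninv => ? _; rewrite mulr_ge0 ?divr_ge0 ?exprn_ge0. Qed.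

Lemma miss_le : q <= u / N.
Proof.
by case/andP: Ninv => ? ?; rewrite ler_piMr ?divr_ge0// exprn_ile1.
Qed.

Lemma miss_le1 : q <= 1.
Proof.
rewrite (le_trans miss_le)// ler_pdivrMr ?mul1r; last by have := N_ge2; lra.
by have := @natr_cardsC R _ S; have := ler0n R #|S|; lra.
Qed.

(** By Bernoulli, [(1 - 1 / N) ^ k >= 1 - k / N = u / N]. *)
Lemma miss_ge_sqr : (u / N) ^+ 2 <= q.
Proof.
rewrite expr2 ler_wpM2l ?divr_ge0//.
have -> : u / N = 1 + k * - N^-1.
  have := @natr_cardsC R _ S; have := N_ge2 => ? E.
  by rewrite -E; field; rewrite E; lra.
by apply: bernoulli_ineq; case/andP: Ninv; lra.
Qed.

(** Needed when u is small and [miss_ge_sqr] is too weak. By Bernoulli the power with exponent n/2,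
    rounded up, is at least 1/4; its square bounds [(1 - 1 / N) ^ k] from below since [k <= n]. *)
Lemma miss_ge : u / N / 16 <= q.
Proof.
rewrite ler_wpM2l ?divr_ge0//.
have half : 4^-1 <= (1 - N^-1) ^+ (uphalf n).
  apply: le_trans (bernoulli_ineq (- N^-1) (uphalf n) _); last by case/andP: Ninv; lra.
  have : (uphalf n)%:R <= 3 / 4 * N.
    have : (4 * uphalf n <= 3 * n)%N.
      by move: n_gt1; rewrite uphalf_half; have := odd_double_half n; case: (odd n) => /=; lia.
    by rewrite -(ler_nat R) !natrM; lra.
  move=> H; suff : (uphalf n)%:R * N^-1 <= 3 / 4 by lra.
  by rewrite ler_pdivrMr//; have := N_ge2; lra.
apply: (@le_trans _ _ ((1 - N^-1) ^+ (uphalf n * 2))).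
  rewrite exprM; have := half; nra.
case/andP: Ninv => ? ?; rewrite ler_wiXn2l//.
rewrite (leq_trans (max_card _))// card_ord; have := odd_double_half n; rewrite uphalf_half.
by case: (odd n) => /=; lia.
Qed.

(** Since [(1 - 1 / N) ^ k * (1 + 1 / N) ^ k <= 1], Bernoulli on the second factor gives
    [(1 - 1 / N) ^ k <= 1 / (1 + k / N)]. *)
Lemma miss_upper : q * (N + k) <= u.
Proof.
have N0 : 0 < N by have := N_ge2; lra.
have b : 1 + k / N <= (1 + N^-1) ^+ #|S|.
  by apply: bernoulli_ineq; rewrite (le_trans (lerN10 _))// invr_ge0 ltW.
have h : (1 - N^-1) ^+ #|S| * (1 + k / N) <= 1.
  case/andP: Ninv => ? ?.
  apply: (@le_trans _ _ ((1 - N^-1) ^+ #|S| * (1 + N^-1) ^+ #|S|)).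
    by rewrite ler_wpM2l ?exprn_ge0.
  have Ni : 0 <= N^-1 by rewrite invr_ge0 ltW.
  have -> : (1 - N^-1) ^+ #|S| * (1 + N^-1) ^+ #|S| = (1 - N^-1 * N^-1) ^+ #|S|.
    by rewrite -exprMn; congr (_ ^+ _); ring.
  have Ni1 : N^-1 * N^-1 <= 1 by rewrite mulr_ile1//; lra.
  by rewrite exprn_ile1// ?subr_ge0// gerBl mulr_ge0.
rewrite /miss (_ : _ * _ = u * ((1 - N^-1) ^+ #|S| * (1 + k / N))) ?ler_piMr//.
by field; rewrite gt_eqF.
Qed.

(** Chebyshev's inequality: below half of the mean [m = u * q] the deviation exceeds [m / 2], while
    the variance is at most m. *)
Lemma avg_cardC_lt (b : R) : 0 < u -> b <= u * q / 2 ->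
  avg (fun c : {ffun 'I_n -> 'I_n} => (u' c < b)%R%:R) <= 4 / (u * q).
Proof.
move=> u0 bm; have q0 : 0 < q.
  apply: lt_le_trans miss_ge; rewrite !divr_gt0// ltr0n ltnW//.
set m := u * q in bm *; have m0 : 0 < m by exact: mulr_gt0.
apply: (@le_trans _ _ (4 / m ^+ 2 * avg (fun c : {ffun 'I_n -> 'I_n} => (u' c - m) ^+ 2))).
  rewrite -avgZ; apply: le_avg => c; rewrite mulrAC ler_pdivlMr ?exprn_gt0//.
  case: ltP => [lt_b|_]; last by rewrite mul0r mulr_ge0 ?sqr_ge0.
  have h1 : 0 <= m - 2 * u' c by lra.
  have h2 : 0 <= 3 * m - 2 * u' c by lra.
  by rewrite mul1r -subr_ge0 (_ : _ - _ = (m - 2 * u' c) * (3 * m - 2 * u' c)) ?mulr_ge0//; ring.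
rewrite (_ : 4 / m = 4 / m ^+ 2 * m); last by field; rewrite gt_eqF.
rewrite ler_wpM2l ?divr_ge0 ?exprn_ge0 ?(ltW m0)//.
rewrite (le_trans (var_cardC_round _ n_gt1))// ler_piMr ?(ltW m0)//; have := ltW q0; lra.
Qed.

End MissBounds.

(** * Elementary bounds on the logarithm *)

Section LnBounds.
Context {R : realType}.

Lemma ln_leB1 (x : R) : 0 < x -> ln x <= x - 1.
Proof.
move=> x0; have := @le_ln1Dx R (x - 1); rewrite [1 + _]addrC subrK; apply; lra.
Qed.

Lemma ln_ge1BV (x : R) : 0 < x -> 1 - x^-1 <= ln x.
Proof.
by move=> x0; have := @ln_leB1 x^-1; rewrite invr_gt0 lnV ?posrE// => /(_ x0); lra.
Qed.

Lemma ln3_ge : 2 / 3 <= ln 3 :> R.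
Proof. by apply: le_trans (@ln_ge1BV 3 _); lra. Qed.

End LnBounds.

(** * The potential for the upper bound *)

Section Upper.
Context {R : realType} {n : nat}.
Variable J : nat.
Hypothesis n_gt1 : (1 < n)%N.
Hypothesis n_leJ : (n <= 2 ^ (2 ^ J))%N.

Local Notation N := (n%:R : R).

Let N_gt0 : 0 < N. Proof. by rewrite ltr0n ltnW. Qed.

(** A concave version of the number of thresholds [N / 2 ^ (2 ^ i)] that y reaches; by [n_leJ] the
    last threshold is at most 1. *)
Definition late_rounds (y : R) : R :=
  \sum_(i < J.+1) Num.min 1 (2 ^+ (2 ^ i) / N * y).

Lemma late_rounds_ge0 y : 0 <= y -> 0 <= late_rounds y.
Proof.
by move=> y0; apply: sumr_ge0 => i _; rewrite le_min ler01 mulr_ge0// divr_ge0// exprn_ge0.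
Qed.

Lemma late_rounds_le y : late_rounds y <= J.+1%:R.
Proof.
have -> : J.+1%:R = \sum_(i < J.+1) 1 :> R by rewrite sumr_const card_ord.
by apply: ler_sum => i _; rewrite ge_min lexx.
Qed.

Lemma le_late_rounds y z : y <= z -> late_rounds y <= late_rounds z.
Proof.
move=> yz; apply: ler_sum => i _; rewrite le_min ge_min lexx/= ge_min orbC.
by rewrite ler_wpM2l// divr_ge0// exprn_ge0.
Qed.

Section Step.
Variable S : {set 'I_n}.
Local Notation k := (#|S|%:R : R).
Local Notation u := (#|~: S|%:R : R).
Local Notation q := (@miss R n S).
Local Notation u' c := (#|~: push_pull_round c S|%:R : R).
Local Notation k' c := (#|push_pull_round c S|%:R : R).

(* The thresholds N / 2 ^ (2 ^ i) are squared (in units of N) from one i to the next, so a round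
   moves each summand at least to where its predecessor was. *)
Lemma avg_late_rounds : 1 <= u ->
  avg (fun c : {ffun 'I_n -> 'I_n} => late_rounds (u' c)) <= late_rounds u - 1 + 2 * (u / N) ^+ 2.
Proof.
move=> u1; have a0 i : 0 <= 2 ^+ (2 ^ i) / N :> R by rewrite divr_ge0// exprn_ge0.
have m_le : u * q <= u ^+ 2 / N by rewrite expr2 -mulrA ler_wpM2l// miss_le.
rewrite avg_sum.
apply: (@le_trans _ _ (\sum_(i < J.+1) Num.min 1 (2 ^+ (2 ^ i) / N * (u ^+ 2 / N)))).
  apply: ler_sum => i _; rewrite le_min; apply/andP; split.
    by rewrite -[leRHS](avg_cst (n := n)); apply: le_avg => c; rewrite ge_min lexx.
  apply: (@le_trans _ _ (2 ^+ (2 ^ i) / N * (u * q))); last by rewrite ler_wpM2l.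
  by rewrite -(avg_cardC _ n_gt1) -avgZ; apply: le_avg => c; rewrite ge_min lexx orbT.
rewrite big_ord_recl addrC lerD//; last first.
  rewrite ge_min; apply/orP; right; rewrite expn0 expr1.
  by rewrite (_ : 2 / N * _ = 2 * (u / N) ^+ 2)//; field; rewrite gt_eqF.
(* The summand of index J equals 1 because [n <= 2 ^ (2 ^ J)] and [1 <= u]; losing it in the shift
   is the progress of one round. *)
rewrite /late_rounds big_ord_recr/= [Num.min 1 (2 ^+ (2 ^ J) / N * u)]min_l ?addrK; last first.
  rewrite mulrAC ler_pdivlMr// mul1r (@le_trans _ _ (2 ^+ (2 ^ J)))//.
    by rewrite -natrX ler_nat.
  by rewrite ler_peMr// exprn_ge0.
apply: ler_sum => i _; rewrite expnSr exprM.
have -> : (2 ^+ (2 ^ i)) ^+ 2 / N * (u ^+ 2 / N) = (2 ^+ (2 ^ i) / N * u) ^+ 2.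
  by field; rewrite gt_eqF.
have : 0 <= 2 ^+ (2 ^ i) / N * u by rewrite mulr_ge0.
move: (_ * u) => x x0; rewrite le_min ge_min lexx/=.
by rewrite ge_min; have [//|x1] := leP 1 x; rewrite expr2 ler_piMl// ltW.
Qed.

(** The left side is the expected number of newly informed nodes. With [t = u / N], [miss_ge_sqr]
    bounds it by [N * t * (1 + t) * (1 - t) <= 2 * N * (1 - t)]. *)
Lemma gain_le : u * (1 - q) <= 2 * k.
Proof.
have kuN := @natr_cardsC R _ S; have := @miss_ge_sqr R n S n_gt1.
have t0 : 0 <= u / N by rewrite divr_ge0.
have t1 : u / N <= 1 by rewrite ler_pdivrMr// mul1r -kuN lerDr.
have [uE kE] : u = N * (u / N) /\ k = N * (1 - u / N).
  have uE : u = N * (u / N) by field; rewrite gt_eqF.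
  by split; rewrite // mulrBr mulr1 -uE -kuN addrK.
move: (u / N) t0 t1 uE kE => t t0 t1 uE kE tq; rewrite uE kE.
rewrite -mulrA [leRHS]mulrCA ler_wpM2l ?(ltW N_gt0)//.
apply: (@le_trans _ _ (t * (1 - t ^+ 2))); first by rewrite ler_wpM2l// lerD2l lerN2.
rewrite (_ : t * _ = (t * (1 + t)) * (1 - t)) ?ler_wpM2r ?subr_ge0//; last by ring.
by nra.
Qed.

(** With [x = k / N], [miss_upper] gives [1 - q >= 2 * x / (1 + x)], and [2 * x * (1 - x) / (1 + x)
    >= 2 * x - 4 * x ^ 2]. *)
Lemma gain_ge : 2 * k - 4 * k ^+ 2 / N <= u * (1 - q).
Proof.
have kuN := @natr_cardsC R _ S; have := @miss_upper R n S n_gt1.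
have x0 : 0 <= k / N by rewrite divr_ge0.
have x1 : k / N <= 1 by rewrite ler_pdivrMr// mul1r -kuN lerDl.
have [kE uE] : k = N * (k / N) /\ u = N * (1 - k / N).
  have kE : k = N * (k / N) by field; rewrite gt_eqF.
  by split; rewrite // mulrBr mulr1 -kE -kuN addrAC subrr add0r.
move: (k / N) x0 x1 kE uE => x x0 x1 kE uE; rewrite uE kE.
rewrite (_ : q * (N + N * x) = N * (q * (1 + x))); last by ring.
rewrite ler_pM2l// => h.
have -> : 2 * (N * x) - 4 * (N * x) ^+ 2 / N = N * (2 * x - 4 * x ^+ 2).
  by field; rewrite gt_eqF.
rewrite -mulrA ler_pM2l// -(@ler_pM2r _ (1 + x)); last by lra.
apply: (@le_trans _ _ (2 * x * (1 - x))); first by nra.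
rewrite -subr_ge0 (_ : _ - _ = (1 - x) * ((1 - x) - q * (1 + x))); last by ring.
by rewrite mulr_ge0 ?subr_ge0.
Qed.

(* For y = k' / (3 k) >= 1/3, the averaged quantity 3 (y - 1)^2 - (y - 1) dominates both - ln y and
   1 / y - 1. *)
Lemma avg_card_near3 : 0 < k -> k <= N / 4 ->
  avg (fun c : {ffun 'I_n -> 'I_n} => (k' c - 3 * k) ^+ 2 / (3 * k ^+ 2) - (k' c - 3 * k) / (3 * k))
  <= 2 / 3 / k + 8 / 3 * (k / N).
Proof.
move=> k0 kN4.
have kuN := @natr_cardsC R _ S.
(* The mean of k' is [3 * k + d]. *)
pose d := u * (1 - q) - 2 * k.
have V : avg (fun c : {ffun 'I_n -> 'I_n} => (u' c - u * q) ^+ 2) <= 2 * k.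
  apply: (le_trans (var_cardC_round _ n_gt1)); apply: le_trans gain_le.
  have q0 := @miss_ge0 R n S n_gt1; have q1 := @miss_le1 R n S n_gt1.
  by rewrite -mulrA ler_wpM2l// ler_piMl// subr_ge0.
have d0 : d <= 0 by rewrite subr_le0 gain_le.
have d1 : - d <= 4 * k ^+ 2 / N by have := gain_ge; rewrite /d; lra.
have k'E (c : {ffun 'I_n -> 'I_n}) : k' c - 3 * k = d - (u' c - u * q).
  have := @natr_cardsC R _ (push_pull_round c S); rewrite /d; lra.
(* Expansion around the mean of u': the linear term averages to 0, and the quadratic one is the
   variance, at most [2 * k] by [V]. *)
have E (c : {ffun 'I_n -> 'I_n}) :
    (k' c - 3 * k) ^+ 2 / (3 * k ^+ 2) - (k' c - 3 * k) / (3 * k) =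
    (3 * k ^+ 2)^-1 * (u' c - u * q) ^+ 2 +
    ((3 * k)^-1 - (2 * d) / (3 * k ^+ 2)) * (u' c - u * q) + (d ^+ 2 / (3 * k ^+ 2) - d / (3 * k)).
  by rewrite k'E; field; rewrite gt_eqF.
have A0 : avg (fun c : {ffun 'I_n -> 'I_n} => u' c - u * q) = 0.
  by rewrite avgB avg_cst avg_cardC// subrr.
rewrite (eq_avg _ _ E) !avgD !avgZ !avg_cst A0 mulr0 addr0.
have -> : 2 / 3 / k + 8 / 3 * (k / N) = (3 * k ^+ 2)^-1 * (2 * k) + 8 / 3 * (k / N).
  by field; rewrite !gt_eqF.
rewrite lerD//; first by rewrite ler_wpM2l// invr_ge0 mulr_ge0// exprn_ge0.
have xE : 4 * k ^+ 2 / N = 4 * (k / N) * k by field; rewrite gt_eqF.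
have e0 : 0 <= - d / k by rewrite divr_ge0// oppr_ge0.
have e1 : - d / k <= 4 * (k / N) by rewrite ler_pdivrMr// -xE.
have x4 : k / N <= 1 / 4 by rewrite ler_pdivrMr// mulrC mulrA mulr1.
have -> : d ^+ 2 / (3 * k ^+ 2) - d / (3 * k) = ((- d / k) ^+ 2 + - d / k) / 3.
  by field; rewrite gt_eqF.
by move: (- d / k) (k / N) e0 e1 x4 => e x e0 e1 x4; nra.
Qed.

Definition upper_potential (A : {set 'I_n}) : R :=
  (ln N - ln #|A|%:R) / ln 3 + 9 / 2 / #|A|%:R + 8 * (#|~: A|%:R / N) + late_rounds #|~: A|%:R.

(** The logarithm drops by 1 up to an error. As k roughly triples, [9 / 2 / k] falls to about a
    third and frees [3 / k]; the term in [u / N] drops by at least [8 * (k / N)] on average.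
    Together they cover the error [3 / k + 4 * (k / N)] of [W]. *)
Lemma upper_potential_early : 0 < k -> k <= N / 4 ->
  1 + avg (fun c : {ffun 'I_n -> 'I_n} => upper_potential (push_pull_round c S)) <=
  upper_potential S.
Proof.
move=> k0 kN4; have Z := avg_card_near3 k0 kN4.
set z := fun c : {ffun 'I_n -> 'I_n} => _ in Z.
have L3 := @ln3_ge R; have L0 : 0 < ln 3 :> R by lra.
have kk' (c : {ffun 'I_n -> 'I_n}) : k <= k' c.
  by rewrite ler_nat subset_leq_card// subset_round.
have kuN := @natr_cardsC R _ S.
have step (c : {ffun 'I_n -> 'I_n}) : upper_potential (push_pull_round c S) <=
    ((ln N - ln k) / ln 3 - 1 + 3 / 2 / k + late_rounds u) +
    ((ln 3)^-1 + 3 / 2 / k) * z c + 8 / N * u' c.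
  have k'0 : 0 < k' c by exact: lt_le_trans (kk' c).
  set y := k' c / (3 * k).
  have y0 : 0 < y by rewrite divr_gt0// mulr_gt0.
  have y3 : y^-1 <= 3.
    by rewrite invf_div ler_pdivrMr//; have := kk' c; lra.
  have zE : z c = 3 * (y - 1) ^+ 2 - (y - 1) by rewrite /z /y; field; rewrite gt_eqF.
  have yV : y^-1 <= 1 + z c.
    (* The remainder of [1 / y] at 1 is exactly [y^-1 * (y - 1) ^+ 2]; as no node is ever lost,
       [y >= 1/3], which yields the factor 3 in z. *)
    rewrite zE (_ : y^-1 = 1 - (y - 1) + y^-1 * (y - 1) ^+ 2); last by field; rewrite gt_eqF.
    by have := ler_wpM2r (sqr_ge0 (y - 1)) y3; lra.
  have k'E : k' c = 3 * k * y by rewrite /y; field; rewrite gt_eqF.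
  have lnE : ln (k' c) = ln 3 + ln k + ln y.
    by rewrite k'E lnM ?posrE ?(mulr_gt0 _ k0)// lnM ?posrE.
  have lny : - ln y <= z c by have := ln_ge1BV _ y0; lra.
  have H1 : (ln N - ln (k' c)) / ln 3 <= (ln N - ln k) / ln 3 - 1 + (ln 3)^-1 * z c.
    rewrite lnE (_ : (ln N - (ln 3 + ln k + ln y)) / ln 3 =
      (ln N - ln k) / ln 3 - 1 + (ln 3)^-1 * (- ln y)); last by field; rewrite gt_eqF.
    by rewrite lerD2l ler_wpM2l// invr_ge0 ltW.
  have H2 : 9 / 2 / k' c <= 3 / 2 / k + 3 / 2 / k * z c.
    rewrite k'E (_ : 9 / 2 / (3 * k * y) = 3 / 2 / k * y^-1); last by field; rewrite !gt_eqF.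
    by rewrite -[X in X + _]mulr1 -mulrDr ler_wpM2l// divr_ge0.
  have H3 : late_rounds (u' c) <= late_rounds u.
    by apply: le_late_rounds; have := kk' c; have := @natr_cardsC R _ (push_pull_round c S); lra.
  rewrite /upper_potential (_ : 8 / N * u' c = 8 * (u' c / N)); last by rewrite mulrAC mulrA.
  by rewrite mulrDl; lra.
apply: le_trans (lerD (lexx 1) (le_avg _ _ step)) _.
rewrite !avgD !avgZ !avg_cst avg_cardC//.
have x4 : k / N <= 1 / 4 by rewrite ler_pdivrMr// mulrC mulrA mulr1.
have x0 : 0 <= k / N by rewrite divr_ge0.
have kV : 0 < k^-1 <= 1.
  by rewrite invr_gt0 k0/= invf_le1// ler1n -(ltr0n R).
have G : 8 / N * (u * q) <= 8 * (u / N) - 8 * (k / N).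
  have -> : 8 / N * (u * q) = 8 * (u / N) - 8 / N * (u * (1 - q)) by field; rewrite gt_eqF.
  have -> : 8 * (k / N) = 8 / N * k by rewrite mulrAC mulrA.
  rewrite lerD2l lerN2 ler_wpM2l ?divr_ge0//; apply: le_trans gain_ge.
  have -> : 4 * k ^+ 2 / N = 4 * (k / N) * k by field; rewrite gt_eqF.
  nra.
have LV : (ln 3)^-1 <= 3 / 2 :> R.
  by rewrite -[leRHS]invrK lef_pV2 ?posrE ?invr_gt0//; lra.
have LV0 : 0 <= (ln 3)^-1 :> R by rewrite invr_ge0 ltW.
(* With [w = 1 / k <= 1] and [x = k / N <= 1/4], the product expands to [w + 4 * x + w ^ 2 + 4 * w *
   x <= 3 * w + 4 * x]. *)
have W : ((ln 3)^-1 + 3 / 2 / k) * avg z <= 3 / k + 4 * (k / N).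
  apply: (@le_trans _ _ ((3 / 2 + 3 / 2 / k) * (2 / 3 / k + 8 / 3 * (k / N)))); last first.
    move: (k^-1) (k / N) kV x0 x4 => w x /andP[w0 w1] x0 x4.
    nra.
  apply: (@le_trans _ _ (((ln 3)^-1 + 3 / 2 / k) * (2 / 3 / k + 8 / 3 * (k / N)))).
    by rewrite ler_wpM2l// addr_ge0// divr_ge0.
  by rewrite ler_wpM2r ?lerD2r// addr_ge0// mulr_ge0// ?divr_ge0// invr_ge0 ltW.
rewrite /upper_potential; lra.
Qed.

(** The terms in k cannot grow and [late_rounds] provides the 1. For [t = u / N <= 3/4], its error
    [2 * t ^ 2] is covered by the decrease [8 * t * (1 - q) >= 8 * t * (1 - t)] of the third
    term. *)
Lemma upper_potential_late : 1 <= u -> N / 4 <= k ->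
  1 + avg (fun c : {ffun 'I_n -> 'I_n} => upper_potential (push_pull_round c S)) <=
  upper_potential S.
Proof.
move=> u1 kN4; have k0 : 0 < k by apply: lt_le_trans kN4; rewrite divr_gt0.
have L0 : 0 < ln 3 :> R by have := @ln3_ge R; lra.
have kuN := @natr_cardsC R _ S.
have step (c : {ffun 'I_n -> 'I_n}) : upper_potential (push_pull_round c S) <=
    ((ln N - ln k) / ln 3 + 9 / 2 / k) + 8 / N * u' c + late_rounds (u' c).
  have kk' : k <= k' c by rewrite ler_nat subset_leq_card// subset_round.
  have k'0 : 0 < k' c by exact: lt_le_trans kk'.
  rewrite /upper_potential !lerD//.
  - by rewrite ler_wpM2r ?invr_ge0 ?(ltW L0)// lerD2l lerN2 ler_ln.
  - by rewrite ler_wpM2l ?lef_pV2//; lra.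
  - by rewrite mulrAC mulrA.
apply: le_trans (lerD (lexx 1) (le_avg _ _ step)) _.
rewrite !avgD !avgZ !avg_cst avg_cardC//.
have M := avg_late_rounds u1.
have qt := @miss_le R n S n_gt1.
have t0 : 0 <= u / N by rewrite divr_ge0.
have t1 : u / N <= 3 / 4 by rewrite ler_pdivrMr//; lra.
have -> : 8 / N * (u * q) = 8 * (u / N * q) by field; rewrite gt_eqF.
rewrite /upper_potential; move: (u / N) t0 t1 qt M => t t0 t1 qt M.
nra.
Qed.

End Step.
End Upper.

(** * The potential for the lower bound *)

Section Lower.
Context {R : realType} {n : nat}.
Variable J : nat.
Hypothesis n_gt1 : (1 < n)%N.
Hypothesis n_geJ : (128 ^ (2 ^ J.+1) <= n)%N.

Local Notation N := (n%:R : R).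
Local Notation y := (128 ^+ (2 ^ J) : R).

Let N_gt0 : 0 < N. Proof. by rewrite ltr0n ltnW. Qed.
Let y_ge1 : 1 <= y. Proof. by rewrite exprn_ege1// ler1n. Qed.
Let y_gt0 : 0 < y. Proof. exact: lt_le_trans y_ge1. Qed.
Let y_sqr_le : y ^+ 2 <= N. Proof. by rewrite -exprM -expnSr -natrX ler_nat. Qed.

(** Closed form of the b_i of the overview, starting at [N / 4]. From [u >= b_i], [miss_ge]
    guarantees a mean of at least [b_i ^ 2 / (16 * N)]; b_(i+1) is half of that, as [avg_cardC_lt]
    requires. *)
Definition late_threshold (i : nat) : R := 32 * N / 128 ^+ (2 ^ i).

Lemma late_threshold_gt0 i : 0 < late_threshold i.
Proof. by rewrite divr_gt0 ?mulr_gt0// exprn_gt0. Qed.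

Lemma late_threshold0 : late_threshold 0 = N / 4.
Proof. by rewrite /late_threshold expn0 expr1; field. Qed.

Lemma late_thresholdS i : late_threshold i ^+ 2 / N / 16 = 2 * late_threshold i.+1.
Proof.
have p : 128 ^+ (2 ^ i) != 0 :> R by rewrite expf_neq0.
by rewrite /late_threshold expnSr exprM; field; rewrite p gt_eqF.
Qed.

Lemma late_threshold_anti i j : (i <= j)%N -> late_threshold j <= late_threshold i.
Proof.
move=> ij; rewrite ler_wpM2l ?mulr_ge0 ?(ltW N_gt0)// lef_pV2 ?posrE ?exprn_gt0//.
by rewrite ler_weXn2l ?ler1n// leq_exp2l.
Qed.

Lemma late_threshold_ge i : (i <= J)%N -> y <= late_threshold i.
Proof.
move=> /late_threshold_anti; apply: le_trans; rewrite /late_threshold ler_pdivlMr ?exprn_gt0//.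
by have := y_sqr_le; have := N_gt0; rewrite expr2; lra.
Qed.

Definition late_rounds_lower (v : R) : R := \sum_(i < J.+1) (late_threshold i <= v)%R%:R.

Lemma late_rounds_lower_le v : late_rounds_lower v <= J.+1%:R.
Proof.
have -> : J.+1%:R = \sum_(i < J.+1) 1 :> R by rewrite sumr_const card_ord.
by apply: ler_sum => i _; rewrite lern1 leq_b1.
Qed.

(** Capping at [N / 10] makes the logarithm vanish in the late phase, so that only one of the two
    terms has to pay for a round. *)
Definition lower_potential (A : {set 'I_n}) : R :=
  (ln (N / 10) - ln (Num.min #|A|%:R (N / 10))) / ln 3 + late_rounds_lower #|~: A|%:R.

(** Union bound: each of the [J.+1] thresholds fails with probability at most [8 / y]. *)
Definition round_error : R := 8 * J.+1%:R / y.

Section Step.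
Variable S : {set 'I_n}.
Local Notation k := (#|S|%:R : R).
Local Notation u := (#|~: S|%:R : R).
Local Notation q := (@miss R n S).
Local Notation u' c := (#|~: push_pull_round c S|%:R : R).
Local Notation k' c := (#|push_pull_round c S|%:R : R).

Let avg_cardC_ge (b : R) : 0 < u -> b <= u * q / 2 -> 0 < b ->
  1 - 2 / b <= avg (fun c : {ffun 'I_n -> 'I_n} => (b <= u' c)%R%:R).
Proof.
move=> u0 bm b0.
have E (c : {ffun 'I_n -> 'I_n}) : (b <= u' c)%R%:R = 1 - (u' c < b)%R%:R :> R.
  by rewrite leNgt; case: (_ < _); rewrite ?subr0 ?subrr.
rewrite (eq_avg _ _ E) avgB avg_cst lerD2l lerN2.
apply: (le_trans (avg_cardC_lt S n_gt1 b u0 bm)).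
rewrite ler_pdivlMr// mulrAC ler_pdivrMr; last by lra.
by lra.
Qed.

(** The tangent bound [ln x <= x - 1] at [x = k' / (3 * k)], with the mean of k' at most [3 * k],
    shows that the logarithm loses at most 1. No threshold is lost unless u' falls below [N / 4]. *)
Lemma lower_potential_early : 0 < k -> k <= N / 10 ->
  lower_potential S <= 1 + round_error +
    avg (fun c : {ffun 'I_n -> 'I_n} => lower_potential (push_pull_round c S)).
Proof.
move=> k0 kN.
have L0 : 0 < ln 3 :> R by have := @ln3_ge R; lra.
have kuN := @natr_cardsC R _ S.
have N10 : 0 < N / 10 by rewrite divr_gt0.
have kk' (c : {ffun 'I_n -> 'I_n}) : k <= k' c.
  by rewrite ler_nat subset_leq_card// subset_round.
have step (c : {ffun 'I_n -> 'I_n}) :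
    ((ln (N / 10) - ln k) / ln 3 - 1) + (ln 3)^-1 * (1 - (3 * k)^-1 * k' c) +
      J.+1%:R * (late_threshold 0 <= u' c)%R%:R <= lower_potential (push_pull_round c S).
  have k'0 : 0 < k' c by exact: lt_le_trans (kk' c).
  rewrite lerD//; last first.
    case: (leP (late_threshold 0) (u' c)) => [le_u'|_]; last by rewrite mulr0 sumr_ge0.
    rewrite mulr1 -[J.+1 in leLHS]card_ord -sumr_const; apply: ler_sum => i _.
    by rewrite (le_trans (late_threshold_anti 0 i (leq0n _)) le_u').
  have p : 0 < k' c / (3 * k) by rewrite divr_gt0// mulr_gt0.
  have lnE : ln (k' c) = ln 3 + ln k + ln (k' c / (3 * k)).
    have k3 : 0 < 3 * k by rewrite mulr_gt0.
    rewrite -[ln 3 + _]lnM ?posrE// -[RHS]lnM ?posrE//; congr (ln _).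
    by field; rewrite gt_eqF.
  have lnk' := @ln_leB1 R _ p.
  have H : ln (Num.min (k' c) (N / 10)) <= ln (k' c).
    by rewrite ler_ln ?posrE ?lt_min ?k'0// ge_min lexx.
  rewrite (_ : _ - 1 + _ = (ln (N / 10) - (ln 3 + ln k + (k' c / (3 * k) - 1))) / ln 3).
    by rewrite ler_wpM2r ?invr_ge0 ?(ltW L0)// lerD2l lerN2; lra.
  by field; rewrite !gt_eqF.
apply: le_trans (lerD (lexx _) (le_avg _ _ step)).
rewrite !avgD !avgZ avgB avgZ !avg_cst avg_card//.
(* [u / N >= 9/10] gives [q >= 81/100], hence [u * q >= N / 2]. *)
have m_ge : N / 4 <= u * q / 2.
  have t9 : 9 / 10 <= u / N by rewrite ler_pdivlMr//; lra.
  have qt := @miss_ge_sqr R n S n_gt1.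
  have -> : u * q = N * (u / N * q) by field; rewrite gt_eqF.
  move: (u / N) t9 qt => t t9 qt.
  have q8 : 81 / 100 <= q by apply: le_trans qt; rewrite expr2; nra.
  have tq : 1 / 2 <= t * q by nra.
  by rewrite -[_ / 2]mulrA ler_pM2l//; lra.
have u0 : 0 < u by have := N_gt0; lra.
have := avg_cardC_ge _ u0 m_ge (divr_gt0 N_gt0 (ltr0n _ 4)).
rewrite -late_threshold0; set P := avg _ => hP.
have gain0 : 0 <= (ln 3)^-1 * (1 - (3 * k)^-1 * (N - u * q)).
  rewrite mulr_ge0 ?invr_ge0 ?(ltW L0)// subr_ge0 mulrC ler_pdivrMr ?mulr_gt0//.
  by have := @gain_le R n n_gt1 S; lra.
have late : late_rounds_lower u <= round_error + J.+1%:R * P.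
  apply: (le_trans (late_rounds_lower_le u)).
  have : J.+1%:R * (1 - 8 / y) <= J.+1%:R * P :> R.
    rewrite ler_wpM2l//; apply: le_trans hP; rewrite lerD2l lerN2 late_threshold0.
    rewrite invf_div mulrA -natrM ler_wpM2l// lef_pV2 ?posrE//.
    by have := y_sqr_le; have := y_ge1; nra.
  by rewrite /round_error; lra.
rewrite /lower_potential min_l//; lra.
Qed.

(** If u reaches threshold i, then u' reaches threshold i + 1 except with small probability, so the
    count drops by at most 1 up to the error. *)
Lemma lower_potential_late : 1 <= u -> N / 10 <= k ->
  lower_potential S <= 1 + round_error +
    avg (fun c : {ffun 'I_n -> 'I_n} => lower_potential (push_pull_round c S)).
Proof.
move=> u1 kN; have u0 : 0 < u by lra.
have step (c : {ffun 'I_n -> 'I_n}) :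
    \sum_(i < J) (late_threshold i.+1 <= u' c)%R%:R <= lower_potential (push_pull_round c S).
  have kk' : k <= k' c by rewrite ler_nat subset_leq_card// subset_round.
  rewrite /lower_potential min_r ?(le_trans kN)// subrr mul0r add0r.
  by rewrite /late_rounds_lower big_ord_recl lerDr.
apply: le_trans (lerD (lexx _) (le_avg _ _ step)).
rewrite avg_sum /lower_potential min_r// subrr mul0r add0r.
(* The summand of index J on the left is paid by the 1; summand i below J is compared with summand i
   + 1 after the round. *)
rewrite /late_rounds_lower big_ord_recr/= [leRHS]addrAC -[leRHS]addrA addrC.
have y0 := y_gt0.
rewrite lerD//; first by rewrite lern1 leq_b1.
have -> : round_error = \sum_(i < J.+1) 8 / y.
  by rewrite sumr_const card_ord /round_error -mulr_natl; ring.
rewrite big_ord_recr/= [leRHS]addrA ler_wpDr ?divr_ge0 ?(ltW y0)// -big_split/=.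
apply: ler_sum => i _; have [bu|_] := leP (late_threshold i) u; last first.
  by rewrite addr_ge0 ?divr_ge0 ?(ltW y0)// avg_ge0.
have b0 := late_threshold_gt0 i.+1.
rewrite mulr1n -lerBlDr; apply: (@le_trans _ _ (1 - 2 / late_threshold i.+1)).
  rewrite lerD2l lerN2 ler_pM// ?invr_ge0 ?(ltW b0)// ?ler_nat//.
  by rewrite lef_pV2 ?posrE// late_threshold_ge.
apply: avg_cardC_ge => //; rewrite ler_pdivlMr// mulrC -late_thresholdS.
apply: (@le_trans _ _ (u * (u / N / 16))); last by rewrite ler_wpM2l// miss_ge.
rewrite !mulrA ler_wpM2r// ler_wpM2r ?invr_ge0 ?(ltW N_gt0)// expr2.
by rewrite ler_pM// ltW// late_threshold_gt0.
Qed.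

End Step.
End Lower.

(** * The chain of informed sets and additive drift *)

Section Chain.
Context {R : realType} {n : nat}.
Implicit Types S : {set 'I_n}.

(** The probability that t rounds from [S] do not inform everyone. The recursion conditions on the
    first round, whereas [informed] adds rounds at the end. *)
Fixpoint unfinished (t : nat) S : R :=
  if t is t'.+1 then avg (fun c : {ffun 'I_n -> 'I_n} => unfinished t' (push_pull_round c S))
  else (S != [set: 'I_n]%SET)%:R.

Lemma round_setT (c : 'I_n -> 'I_n) : push_pull_round c [set: 'I_n]%SET = [set: 'I_n]%SET.
Proof. exact: finset.setTU. Qed.

Lemma unfinished_ge0 t S : 0 <= unfinished t S.
Proof. by elim: t S => [|t IH] S /=; [exact: ler0n | exact: avg_ge0]. Qed.

Lemma unfinished_setT t : unfinished t [set: 'I_n]%SET = 0.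
Proof.
elim: t => [|t IH] /=; first by rewrite eqxx.
by rewrite -[RHS](avg_cst (n := n)); apply: eq_avg => c; rewrite round_setT.
Qed.

Lemma unfinishedS_le t S : unfinished t.+1 S <= unfinished t S.
Proof.
elim: t S => [|t IH] S; last by apply: le_avg => c; exact: IH.
rewrite /= -[leRHS](avg_cst (n := n)); apply: le_avg => c; rewrite ler_nat.
have [->|_] := eqVneq S [set: 'I_n]%SET; last exact: leq_b1.
by rewrite round_setT eqxx.
Qed.

Lemma sum_unfinishedS m S : \sum_(t < m.+1) unfinished t S = unfinished 0 S +
  avg (fun c : {ffun 'I_n -> 'I_n} => \sum_(t < m) unfinished t (push_pull_round c S)).
Proof. by rewrite big_ord_recl avg_sum. Qed.

Lemma unfinished_le_mean m S : m%:R * unfinished m S <= \sum_(t < m) unfinished t S.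
Proof.
have anti j : (j <= m)%N -> unfinished m S <= unfinished j S.
  elim: m => [|m IH]; first by rewrite leqn0 => /eqP->.
  rewrite leq_eqVlt => /orP[/eqP->//|]; rewrite ltnS => /IH.
  exact: le_trans (unfinishedS_le _ _).
have -> : m%:R * unfinished m S = \sum_(t < m) unfinished m S.
  by rewrite sumr_const card_ord mulr_natl.
by apply: ler_sum => i _; exact/anti/ltnW.
Qed.

Lemma card_round_gt0 (c : 'I_n -> 'I_n) S : (0 < #|S|)%N -> (0 < #|push_pull_round c S|)%N.
Proof. by move=> S0; rewrite (leq_trans S0)// subset_leq_card// subset_round. Qed.

(** Additive drift: a nonnegative potential that loses at least 1 per round in expectation bounds
    the truncated expected time. *)
Lemma sum_unfinished_le (F : {set 'I_n} -> R) :
  (forall S, (0 < #|S|)%N -> 0 <= F S) ->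
  (forall S, (0 < #|S|)%N -> S != [set: 'I_n]%SET ->
    1 + avg (fun c : {ffun 'I_n -> 'I_n} => F (push_pull_round c S)) <= F S) ->
  forall m S, (0 < #|S|)%N -> \sum_(t < m) unfinished t S <= F S.
Proof.
move=> F0 F1; elim=> [|m IH] S S0; first by rewrite big_ord0 F0.
have [->|SN] := eqVneq S [set: 'I_n]%SET.
  rewrite big1 => [|t _]; last exact: unfinished_setT.
  apply: F0; apply: (leq_trans S0); exact: subset_leq_card (finset.subsetT _).
rewrite sum_unfinishedS /= SN (le_trans _ (F1 _ S0 SN))// lerD2l.
by apply: le_avg => c; rewrite IH// card_round_gt0.
Qed.

(** The converse drift bound: a potential loses at most r per round, and what remains after m rounds
    is at most M on unfinished runs. *)
Lemma le_sum_unfinished (F : {set 'I_n} -> R) (M r : R) : 0 <= r ->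
  (forall S, (0 < #|S|)%N -> F S <= M) -> F [set: 'I_n]%SET <= 0 ->
  (forall S, (0 < #|S|)%N -> S != [set: 'I_n]%SET ->
    F S <= r + avg (fun c : {ffun 'I_n -> 'I_n} => F (push_pull_round c S))) ->
  forall m S, (0 < #|S|)%N ->
    F S <= r * (\sum_(t < m) unfinished t S) + M * unfinished m S.
Proof.
move=> r0 FM FT F1; elim=> [|m IH] S S0; have [->|SN] := eqVneq S [set: 'I_n]%SET.
- by rewrite big_ord0 unfinished_setT !mulr0 addr0.
- by rewrite big_ord0 mulr0 add0r /= SN mulr1 FM.
- rewrite big1 => [|t _]; last exact: unfinished_setT.
  by rewrite unfinished_setT !mulr0 addr0.
rewrite sum_unfinishedS /= SN mulrDr mulr1 -addrA (le_trans (F1 _ S0 SN))// lerD2l.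
rewrite -!avgZ -avgD; apply: le_avg => c; exact: (IH _ (card_round_gt0 c _ S0)).
Qed.

(** Let m grow in [le_sum_unfinished]: the tail probabilities decrease and have sums bounded by E,
    so [unfinished m S <= E / m] and the remainder vanishes. *)
Lemma le_sup_sum_unfinished (F : {set 'I_n} -> R) (M r E : R) S : 0 <= r ->
  (forall S, (0 < #|S|)%N -> F S <= M) -> F [set: 'I_n]%SET <= 0 ->
  (forall S, (0 < #|S|)%N -> S != [set: 'I_n]%SET ->
    F S <= r + avg (fun c : {ffun 'I_n -> 'I_n} => F (push_pull_round c S))) ->
  (0 < #|S|)%N -> (forall m, \sum_(t < m) unfinished t S <= E) -> F S <= r * E.
Proof.
move=> r0 FM FT F1 S0 SE; apply/ler_addgt0Pr => e e0.
have E0 : 0 <= E by have := SE 0%N; rewrite big_ord0.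
have M0 : 0 <= `|M| * E by rewrite mulr_ge0.
pose m := (Num.bound (`|M| * E / e)).+1.
have m0 : 0 < m%:R :> R by rewrite ltr0n.
have mP : `|M| * E <= e * m%:R.
  rewrite [leRHS]mulrC -ler_pdivrMr//; apply: ltW; apply: (lt_le_trans (archi_boundP (divr_ge0 M0 (ltW e0)))).
  by rewrite ler_nat /m.
apply: (le_trans (le_sum_unfinished F M r r0 FM FT F1 m _ S0)).
apply: lerD; first by rewrite ler_wpM2l.
have Q0 := unfinished_ge0 m S.
apply: (@le_trans _ _ (`|M| * unfinished m S)); first by rewrite ler_wpM2r// ler_norm.
rewrite -(ler_pM2r m0) (le_trans _ mP)// -mulrA ler_wpM2l// mulrC.
exact: le_trans (unfinished_le_mean _ _) (SE m).
Qed.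

End Chain.

(** * Evaluation of both potentials at a single informed node *)

Section SumBounds.
Context {R : realType} {n : nat}.

Definition log3_log2ln (m : nat) : R := ln m%:R / ln 3 + ln (ln m%:R) / ln 2.

Local Notation N := (n%:R : R).

Let card_gt0_ge1 (S : {set 'I_n}) : S != [set: 'I_n]%SET -> 1 <= #|~: S|%:R :> R.
Proof.
move=> SN; rewrite ler1n card_gt0; apply: contra SN => /eqP SC.
by rewrite -[S]finset.setCK SC finset.setC0.
Qed.

Lemma ln2_ge : 1 / 2 <= ln 2 :> R.
Proof. by apply: le_trans (ln_ge1BV 2 _); lra. Qed.

Lemma ln2_le1 : ln 2 <= 1 :> R.
Proof. by apply: le_trans (ln_leB1 2 _) _; lra. Qed.

Lemma sum_unfinished_upper (v0 : 'I_n) (m : nat) : (1 < n)%N ->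
  \sum_(t < m) @unfinished R n t [set v0]%SET <= log3_log2ln n + 17.
Proof.
move=> n1; pose a := trunc_log 2 n; pose b := trunc_log 2 a.
have n0 : (0 < n)%N by exact: ltnW.
have a0 : (0 < a)%N by rewrite trunc_log_gt0.
have nJ : (n <= 2 ^ 2 ^ b.+1)%N.
  by rewrite (leq_trans (ltnW (trunc_log_ltn n (ltnSn 1))))// leq_exp2l// trunc_log_ltn.
have L2 := ln2_ge; have L3 := @ln3_ge R; have L1 := ln2_le1.
have L30 : 0 < ln 3 :> R by lra.
have L20 : 0 < ln 2 :> R by lra.
have N1 : 1 < N by rewrite ltr1n.
have N0 : 0 < N by lra.
have lnN : a%:R * ln 2 <= ln N.
  by rewrite mulr_natl -lnXn// ler_ln ?posrE ?exprn_gt0// -natrX ler_nat trunc_logP.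
have lna : b%:R * ln 2 <= ln a%:R :> R.
  by rewrite mulr_natl -lnXn// ler_ln ?posrE ?exprn_gt0 ?ltr0n// -natrX ler_nat trunc_logP.
have lnN0 : 0 < ln N by rewrite ln_gt0.
have b_le : b%:R <= ln (ln N) / ln 2 + 1.
  rewrite -(ler_pM2r L20) mulrDl mul1r divfK ?gt_eqF// (le_trans lna)//.
  (* [a * ln 2 <= ln N] and [ln 2 >= 1/2]; the factor 2 becomes the 1 in [b_le]. *)
  have : ln a%:R <= ln (2 * ln N).
    by rewrite ler_ln ?posrE ?ltr0n ?mulr_gt0//; have := ler0n R a; nra.
  by rewrite lnM ?posrE//; lra.
apply: (le_trans (sum_unfinished_le (upper_potential b.+1) _ _ m _ _)).
- move=> S S0; have k1 : 1 <= #|S|%:R :> R by rewrite ler1n.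
  have kN := @natr_cardsC R n S; have u0 := ler0n R #|~: S|.
  rewrite /upper_potential !addr_ge0 ?late_rounds_ge0//.
  rewrite divr_ge0 ?(ltW L30)// subr_ge0 ler_ln ?posrE//; lra.
- move=> S S0 SN; have [kN|kN] := leP (#|S|%:R) (N / 4).
    by apply: upper_potential_early; rewrite ?ltr0n.
  by apply: upper_potential_late; rewrite ?card_gt0_ge1// ltW.
- by rewrite cards1.
(* The constant collects 9/2 and 8 from the middle terms and 3 from
   [b + 2 <= ln (ln N) / ln 2 + 3]. *)
- rewrite /upper_potential cards1 ln1 subr0 /log3_log2ln.
  have uN : #|~: [set v0]%SET|%:R / N <= 1.
    by rewrite ler_pdivrMr// mul1r ler_nat -[leqRHS]card_ord max_card.
  have := @late_rounds_le R n b.+1 #|~: [set v0]%SET|%:R.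
  rewrite -[b.+2%:R]natr1 -[b.+1%:R]natr1 invr1 mulr1; lra.
Qed.

(** Drift yields only [(1 + round_error J) * E]. The upper bound on E turns this into an additive
    constant: E is of order [2 ^ J], while the error decays like [J / 128 ^ (2 ^ J)]. *)
Lemma sum_unfinished_lower (v0 : 'I_n) (E : R) : (128 ^ 2 <= n)%N ->
  (forall m, \sum_(t < m) @unfinished R n t [set v0]%SET <= E) ->
  E <= log3_log2ln n + 17 -> log3_log2ln n - 600 <= E.
Proof.
move=> n128 SE EU; pose a := trunc_log 128 n.
have n0 : (0 < n)%N by apply: leq_trans n128; rewrite expn_gt0.
have a2 : (2 <= a)%N by rewrite trunc_log_max.
(* The largest J allowed by [n_geJ], so that also [n <= 128 ^ (2 ^ J.+2)]. *)
have [J JP] : exists J, trunc_log 2 a = J.+1.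
  exists (trunc_log 2 a).-1; rewrite prednK// trunc_log_gt0//; lia.
have n1 : (1 < n)%N by rewrite (leq_trans _ n128)// -[1%N](expn0 128) ltn_exp2l.
have nJ : (128 ^ 2 ^ J.+1 <= n)%N.
  apply: (@leq_trans (128 ^ a)); last by rewrite trunc_logP.
  by rewrite leq_exp2l// -JP trunc_logP//; lia.
have nJ2 : (n <= 128 ^ 2 ^ J.+2)%N.
  apply: (@leq_trans (128 ^ a.+1)); first by rewrite ltnW// trunc_log_ltn.
  by rewrite leq_exp2l// -JP trunc_log_ltn.
have L2 := ln2_ge; have L3 := @ln3_ge R; have L1 := ln2_le1.
have L30 : 0 < ln 3 :> R by lra.
have L20 : 0 < ln 2 :> R by lra.
have N100 : 100 <= N by rewrite ler_nat; apply: leq_trans n128.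
have N0 : 0 < N by lra.
(* [128 = 2 ^ 7], and [7 * 2 ^ J.+2 * ln 2 <= 8 * 2 ^ J.+2]. *)
have lnN : ln N <= 2 ^+ (J + 5).
  apply: (@le_trans _ _ (ln (2 ^+ (7 * 2 ^ J.+2)))).
    by rewrite ler_ln ?posrE ?exprn_gt0// exprM -!natrX ler_nat.
  rewrite lnXn// -[ln 2 *+ _]mulr_natl natrM natrX.
  have -> : (J + 5 = 3 + J.+2)%N by lia.
  rewrite exprD; have : 0 <= 2 ^+ J.+2 :> R by rewrite exprn_ge0.
  move: (2 ^+ J.+2) => w w0; nra.
have lnN0 : 0 < ln N by rewrite ln_gt0//; lra.
have lnlnN : ln (ln N) / ln 2 <= J%:R + 5.
  rewrite ler_pdivrMr// -natrD mulr_natl -lnXn// ler_ln ?posrE ?exprn_gt0//.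
have w1 : J%:R + 1 <= 2 ^+ J :> R by rewrite natr1 -natrX ler_nat ltn_expl.
have w_ge1 : 1 <= 2 ^+ J :> R by have := ler0n R J; lra.
have e0 : 0 <= @round_error R J by rewrite divr_ge0 ?exprn_ge0// mulr_ge0.
have FE : lower_potential J [set v0]%SET <= (1 + round_error J) * E.
  apply: (le_sup_sum_unfinished (lower_potential J) (ln N / ln 3 + J.+1%:R)) => //.
  - by rewrite addr_ge0.
  - move=> S S0; rewrite /lower_potential lerD ?late_rounds_lower_le//.
    rewrite ler_wpM2r ?invr_ge0 ?(ltW L30)// lerBlDr ler_wpDr//.
      by rewrite ln_ge0// le_min ler1n S0/=; lra.
    by rewrite ler_ln ?posrE//; lra.
  - rewrite /lower_potential cardsT card_ord min_r; last by lra.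
    rewrite subrr mul0r add0r finset.setCT cards0 /late_rounds_lower big1// => i _.
    by rewrite leNgt late_threshold_gt0.
  - move=> S S0 SN; have [kN|kN] := leP (#|S|%:R) (N / 10).
      by apply: lower_potential_early; rewrite ?ltr0n.
    by apply: lower_potential_late; rewrite ?card_gt0_ge1// ltW.
  - by rewrite cards1.
(* 3 is lost to [N / 10] since [10 <= 3 ^ 3], and 4 since [J + 1 >= ln (ln N) / ln 2 - 4]. *)
have F0 : log3_log2ln n - 7 <= lower_potential J [set v0]%SET.
  rewrite /lower_potential cards1 min_l; last by lra.
  have lateE : @late_rounds_lower R n J #|~: [set v0]%SET|%:R = J.+1%:R :> R.
    have -> : J.+1%:R = \sum_(i < J.+1) 1 :> R by rewrite sumr_const card_ord.
    rewrite /late_rounds_lower. apply: eq_bigr => i _.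
    rewrite (le_trans (late_threshold_anti n1 0 i (leq0n _)))// late_threshold0.
    by have := @natr_cardsC R n [set v0]%SET; rewrite cards1; lra.
  have ln27 : ln N - 3 * ln 3 <= ln (N / 10).
    rewrite lerBlDr [3 * _]mulr_natl -lnXn// -lnM ?posrE ?exprn_gt0//; last by lra.
    by rewrite ler_ln ?posrE ?mulr_gt0 ?exprn_gt0 ?invr_gt0//; lra.
  have : ln N / ln 3 - 3 <= ln (N / 10) / ln 3.
    by rewrite ler_pdivlMr// mulrBl divfK// gt_eqF.
  by rewrite lateE ln1 subr0 /log3_log2ln -natr1; lra.
(* 560 is 8 from [round_error] times 70 from [E_le]; the remaining [(J + 1) * 2 ^ J] is at most
   [4 ^ (2 ^ J)]. *)
have errE : round_error J * E <= 560.
  have E_le : E <= 70 * 2 ^+ J.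
    apply: (le_trans EU); rewrite /log3_log2ln.
    have : ln N / ln 3 <= 48 * 2 ^+ J.
      by rewrite ler_pdivrMr//; move: lnN; rewrite exprD; nra.
    by lra.
  have wV : 2 ^+ J * 2 ^+ J <= 128 ^+ (2 ^ J) :> R.
    rewrite -natrX -natrM -natrX ler_nat; set w := (2 ^ J)%N.
    have w2 : (w <= 2 ^ w)%N by rewrite ltnW// ltn_expl.
    by rewrite (leq_trans (leq_mul w2 w2))// -expnMn leq_exp2r// expn_gt0.
  rewrite /round_error mulrAC ler_pdivrMr ?exprn_gt0//.
  apply: (@le_trans _ _ (8 * 2 ^+ J * (70 * 2 ^+ J))); last by lra.
  have J0 := ler0n R J; rewrite -[J.+1%:R]natr1.
  apply: (@le_trans _ _ (8 * (J%:R + 1) * (70 * 2 ^+ J))).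
    by rewrite ler_wpM2l// mulr_ge0// addr_ge0.
  by rewrite ler_wpM2r ?ler_wpM2l// mulr_ge0// exprn_ge0.
have : (1 + round_error J) * E = E + round_error J * E by ring.
lra.
Qed.

End SumBounds.

Local Open Scope classical_set_scope.

(** * The spreading time as a sum of tail indicators *)

Section SpreadingTime.
Context {R : realType}.

Lemma nneseries_le_bound (u : nat -> \bar R) (B : \bar R) : (forall t, 0 <= u t)%E ->
  (forall m, \sum_(0 <= t < m) u t <= B)%E -> (\sum_(0 <= t <oo) u t <= B)%E.
Proof.
move=> u0 uB; apply: lime_le; first exact: is_cvg_nneseries.
by apply: nearW => m; exact: uB.
Qed.

Lemma informed_full_mono {n : nat} (c : nat -> 'I_n -> 'I_n) v0 s t : (s <= t)%N ->
  informed c v0 s = [set: 'I_n]%SET -> informed c v0 t = [set: 'I_n]%SET.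
Proof.
move=> /subnK <-; elim: (t - s)%N => [//|j IH] /IH full.
by rewrite addSn /= full round_setT.
Qed.

(** The full set is absorbing, so the first time it is reached counts the rounds before it; if it is
    never reached, both sides are [+oo]. *)
Lemma spreading_timeE {n : nat} (c : nat -> 'I_n -> 'I_n) (v0 : 'I_n) :
  spreading_time R c v0 =
  (\sum_(0 <= t <oo) ((informed c v0 t != [set: 'I_n]%SET)%:R : R)%:E)%E.
Proof.
set f := fun t : nat => (informed c v0 t != [set: 'I_n]%SET).
have f0 t : (0 <= ((f t)%:R : R)%:E)%E by rewrite lee_fin.
have [[t ft]|nofull] := pselect (exists t, ~~ f t).
  have [t0 ft0 t0_min] := ex_minnP (ex_intro (fun t => ~~ f t) t ft).
  have -> : spreading_time R c v0 = (t0%:R)%:E.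
    apply/eqP; rewrite eq_le; apply/andP; split.
      by apply: ereal_inf_lbound; exists t0 => //; move: ft0; rewrite negbK => /eqP.
    apply: le_ereal_inf_tmp => _ [s sfull <-]; rewrite lee_fin ler_nat; apply: t0_min.
    by rewrite /f sfull eqxx.
  apply/eqP; rewrite eq_le; apply/andP; split.
    apply: (@le_trans _ _ (\sum_(0 <= t < t0) ((f t)%:R : R)%:E)%E); last first.
      exact: nneseries_lim_ge.
    rewrite sumEFin lee_fin (eq_big_nat _ _ (F2 := fun=> 1)) => [|s /andP[_ st0]].
      by rewrite big_const_nat subn0 iter_addr_0.
    by case fs: (f s) => //; have := t0_min s; rewrite fs leqNgt st0 => /(_ isT).
  apply: nneseries_le_bound => // m; rewrite sumEFin lee_fin.
  suff : \sum_(0 <= t < m) (f t)%:R <= (minn m t0)%:R :> R.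
    by move/le_trans; apply; rewrite ler_nat geq_minr.
  elim: m => [|m IH]; first by rewrite big_geq.
  rewrite big_nat_recr//= (le_trans (lerD IH (lexx _)))//.
  have [mt0|t0m] := ltnP m t0.
    by rewrite (minn_idPl mt0) -natrD ler_nat -[leqRHS]addn1 leq_add2l leq_b1.
  suff -> : f m = false by rewrite addr0 (minn_idPr (leqW t0m)).
  by move: ft0; rewrite /f negbK => /eqP /(informed_full_mono _ _ _ _ t0m) ->; rewrite eqxx.
have ft t : f t by apply: contra_notT nofull => ?; exists t.
transitivity (+oo : \bar R)%E.
  rewrite /spreading_time (_ : [set _ | _ in _] = set0) ?ereal_inf0//.
  by apply/seteqP; split => // x [t tfull _]; have := ft t; rewrite /f tfull eqxx.
apply/esym/eqyP => A A0; pose m := Num.bound A.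
apply: (@le_trans _ _ (\sum_(0 <= t < m) ((f t)%:R : R)%:E)%E); last exact: nneseries_lim_ge.
rewrite sumEFin lee_fin (eq_bigr (fun=> 1)) => [|t _]; last by rewrite ft.
by rewrite big_const_nat subn0 iter_addr_0 ltW// archi_boundP// ltW.
Qed.
End SpreadingTime.

(** * From the random calls to the chain *)

Section Law.
Context d (Omega : measurableType d) {R : realType} (P : probability Omega R) {n : nat}.
Variables (call : nat -> 'I_n -> Omega -> 'I_n) (v0 : 'I_n).
Hypothesis rc : random_calls P call.

Local Notation N := (n%:R : R).
Local Notation calls w := (fun t v => call t v w).

Definition call_history (s : nat) (h : nat -> {ffun 'I_n -> 'I_n}) : set Omega :=
  [set w | forall t v, (t < s)%N -> call t v w = h t v].

(** Written as an intersection over a finite set of pairs (t, v), the cylinder event fits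
    [mutually_independent]. *)
Lemma call_historyE s h : call_history s h =
  \bigcap_(j in [set` [fset x in [seq (t, v) | t <- iota 0 s, v <- enum 'I_n]]%fset])
    (call j.1 j.2 @^-1` [set h j.1 j.2]).
Proof.
apply/seteqP; split => [w hw [t v] /=|w hw t v ts].
  by rewrite !inE => /allpairsP[[t' v'] [/= + _ [-> ->]]]; rewrite mem_iota => /andP[_ ts]; exact: hw.
apply: (hw (t, v)); rewrite /= !inE; apply/allpairsP; exists (t, v).
by rewrite mem_iota mem_enum.
Qed.

Lemma measurable_call_history s h : measurable (call_history s h).
Proof.
rewrite call_historyE; apply: fin_bigcap_measurable; first exact: finite_fset.
by move=> j _; exact: calls_measurable rc _ _ _.
Qed.

Lemma prob_call_history s h : P (call_history s h) = ((N ^+ n)^-1 ^+ s)%:E.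
Proof.
rewrite call_historyE (calls_independent rc _ (fun j => [set h j.1 j.2])).
under eq_bigr do rewrite (calls_uniform rc).
rewrite prodEFin; congr EFin.
rewrite big_const_seq count_predT iter_mulr_1 exprVn -exprM -exprVn.
congr (_ ^+ _); rewrite -[size _]/(#|` _|%fset) card_fseq undup_id ?size_allpairs ?size_iota.
  by rewrite size_enum_ord mulnC.
by apply: allpairs_uniq; rewrite ?iota_uniq ?enum_uniq// => -[? ?] [? ?].
Qed.

Lemma informed_ext s (c c' : nat -> 'I_n -> 'I_n) :
  (forall t v, (t < s)%N -> c t v = c' t v) -> informed c v0 s = informed c' v0 s.
Proof.
elim: s => [//|s IH] cc' /=; rewrite IH => [|t v ts]; last by apply: cc'; exact: ltnW.
by congr push_pull_round; apply/funext => v; exact: cc'.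
Qed.

Lemma measurable_informed t (S : {set 'I_n}) :
  measurable [set w | informed (calls w) v0 t = S].
Proof.
elim: t S => [|t IH] S.
  have [eS|neS] := pselect ([set v0]%SET = S).
    by rewrite (_ : [set w | _] = setT) //; apply/seteqP; split.
  by rewrite (_ : [set w | _] = set0) //; apply/seteqP; split.
rewrite (_ : [set w | _] =
    \bigcup_(p in [set p : {set 'I_n} * {ffun 'I_n -> 'I_n} | push_pull_round p.2 p.1 = S])
      ([set w | informed (calls w) v0 t = p.1] `&`
       \bigcap_(v in [set: 'I_n]) (call t v @^-1` [set p.2 v]))); last first.
  apply/seteqP; split => [w /= wS|w [[S' c] /= cS [/= -> cw]]].
    exists (informed (calls w) v0 t, [ffun v => call t v w]) => /=.
      by rewrite -[RHS]wS; congr push_pull_round; apply/funext => v; rewrite ffunE.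
    by split=> // v _; rewrite /= ffunE.
  by rewrite -[RHS]cS; congr push_pull_round; apply/funext => v; exact: cw.
apply: fin_bigcup_measurable => [|p _]; first exact: finite_finset.
apply: measurableI; first exact: IH.
apply: fin_bigcap_measurable => [|v _]; first exact: finite_finset.
exact: calls_measurable rc _ _ _.
Qed.

Definition unfinished_set t : set Omega :=
  [set w | informed (calls w) v0 t != [set: 'I_n]%SET].

Lemma measurable_unfinished t : measurable (unfinished_set t).
Proof.
rewrite (_ : unfinished_set t = ~` [set w | informed (calls w) v0 t = [set: 'I_n]%SET]).
  exact/measurableC/measurable_informed.
by apply/seteqP; split => w /eqP.
Qed.

(** The Markov property. Keeping the history arbitrary lets the induction on t split the event over
    all call functions of round s, which matches the recursion of [unfinished]. *)
Lemma prob_history_unfinished t s h :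
  P (call_history s h `&` unfinished_set (s + t)) =
  ((N ^+ n)^-1 ^+ s * unfinished t (informed (fun i => h i) v0 s))%:E.
Proof.
elim: t s h => [|t IH] s h.
  rewrite addn0 /=.
  have hE w : call_history s h w -> informed (calls w) v0 s = informed (fun i => h i) v0 s.
    by move=> hw; apply: informed_ext => t v; exact: hw.
  have [full|nfull] := eqVneq (informed (fun i => h i) v0 s) [set: 'I_n]%SET.
    rewrite mulr0 (_ : _ `&` _ = set0) ?measure0//.
    by apply/seteqP; split => // w [/hE]; rewrite /unfinished_set/= full => ->; rewrite eqxx.
  rewrite mulr1 (_ : _ `&` _ = call_history s h) ?prob_call_history//.
  by apply/seteqP; split => [w []//|w hw]; split => //; rewrite /unfinished_set/= (hE _ hw).
pose upd (c : {ffun 'I_n -> 'I_n}) i := if i == s then c else h i.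
have -> : call_history s h `&` unfinished_set (s + t.+1) =
    \bigcup_(c in [set` enum {: {ffun 'I_n -> 'I_n}}])
      (call_history s.+1 (upd c) `&` unfinished_set (s.+1 + t)).
  rewrite addnS -addSn; apply/seteqP; split => [w [hw uw]|w [c _ [hw uw]]].
    exists [ffun v => call s v w]; first by rewrite /= mem_enum.
    split=> // i v; rewrite ltnS leq_eqVlt /upd; case: eqP => [-> _|_ /=]; last exact: hw.
    by rewrite ffunE.
  split=> // i v si; rewrite hw ?ltnS 1?ltnW// /upd; case: eqP => // si'.
  by move: si; rewrite si' ltnn.
rewrite measure_fin_bigcup//=; last 2 first.
- move=> c c' _ _ [w [[hw _] [hw' _]]]; apply/ffunP => v.
  by have := hw s v (ltnSn s); rewrite hw'// /upd eqxx.
- by move=> c _; apply: measurableI; [exact: measurable_call_history|exact: measurable_unfinished].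
rewrite -fsbig_seq ?enum_uniq// big_enum/=.
under eq_bigr do rewrite IH.
rewrite sumEFin -mulr_sumr exprSr -mulrA; congr ((_ * _)%:E).
rewrite /avg; congr (_ * _); apply: eq_bigr => c _; congr unfinished.
rewrite /= /upd eqxx; congr push_pull_round; apply: informed_ext => i v si.
by case: eqP => // si'; move: si; rewrite si' ltnn.
Qed.

Lemma prob_unfinished t : P (unfinished_set t) = (unfinished t [set v0]%SET)%:E.
Proof.
have := prob_history_unfinished t 0 (fun=> [ffun v => v]).
rewrite add0n expr0 mul1r (_ : call_history _ _ = setT) ?setTI//.
by apply/seteqP; split.
Qed.

(** Integrate the indicator series term by term, by monotone convergence. *)
Lemma expected_spreading_timeE : expected_spreading_time P call v0 =
  (\sum_(0 <= t <oo) (unfinished t [set v0]%SET)%:E)%E.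
Proof.
rewrite /expected_spreading_time.
under eq_integral do rewrite spreading_timeE.
have E t w : (((informed (calls w) v0 t != [set: 'I_n]%SET)%:R : R)%:E =
    (\1_(unfinished_set t) w)%:E)%E.
  rewrite indicE; congr ((nat_of_bool _)%:R%:E).
  by apply/idP/idP; rewrite inE.
rewrite integral_nneseries//.
- apply: eq_eseriesr => t _.
  under eq_integral do rewrite E.
  rewrite integral_indic ?setIT//; first exact: prob_unfinished.
  exact: measurable_unfinished.
- move=> t; rewrite (_ : (fun w => _) = EFin \o \1_(unfinished_set t)).
    exact/measurable_EFinP/measurable_indic/measurable_unfinished.
  by apply/funext => w; exact: E.
Qed.

End Law.

(** * Transfer of both bounds to the expectation *)

Theorem theorem53 (R : realType) :
  exists (C : R) (n0 : nat), forall n : nat, (n0 <= n)%N ->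
    forall (d : measure_display) (Omega : measurableType d)
      (P : probability Omega R) (call : nat -> 'I_n -> Omega -> 'I_n)
      (v0 : 'I_n),
    random_calls P call ->
    (`| expected_spreading_time P call v0
        - (ln n%:R / ln 3 + ln (ln n%:R) / ln 2)%:E | <= C%:E)%E.
Proof.
(* 600 covers the lower deviation, and thus also the upper one of 17; [128 ^ 2] makes J exist in the
   lower bound. *)
exists 600, (128 ^ 2)%N => n n128 d Omega P call v0 rc.
have n1 : (1 < n)%N by rewrite (leq_trans _ n128)// -[1%N](expn0 128) ltn_exp2l.
have u0 t : (0 <= (@unfinished R n t [set v0]%SET)%:E)%E by rewrite lee_fin unfinished_ge0.
have upper : (expected_spreading_time P call v0 <= (log3_log2ln n + 17)%:E)%E.
  rewrite expected_spreading_timeE//; apply: nneseries_le_bound => // m.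
  by rewrite sumEFin lee_fin big_mkord sum_unfinished_upper.
have lower m : ((\sum_(t < m) @unfinished R n t [set v0]%SET)%:E <=
    expected_spreading_time P call v0)%E.
  rewrite expected_spreading_timeE// -sumEFin.
  rewrite -(big_mkord xpredT (fun t => (unfinished t [set v0]%SET)%:E)).
  exact: nneseries_lim_ge.
have := fun E : R => sum_unfinished_lower v0 E n128.
move: upper lower; rewrite -/(log3_log2ln n).
(* [upper] excludes [+oo], and the empty sum in [lower] excludes [-oo]. *)
case: (expected_spreading_time P call v0) => [E| |]; last 2 first.
- by rewrite leye_eq.
- by move=> _ /(_ 0%N).
rewrite lee_fin => upper lower /(_ E (fun m => lower m) upper) lowerE.
rewrite -EFinB abse_EFin lee_fin ler_norml; apply/andP; split; lra.
Qed.
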